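(* Let $t\in[-1,1]$, let $\mathcal{B}_t$ be the set of all bivariate copulas $C$ with Blomqvist's beta $\beta(C)=t$, and let $\underline{B}_t=\inf\mathcal{B}_t$ and $\overline{B}_t=\sup\mathcal{B}_t$ be its pointwise infimum and supremum. Then Kendall's tau satisfies (a) $\tau(\underline{B}_t)=\dfrac{(1+t)^2}{4}-1$, and (b) $\tau(\overline{B}_t)=1-\dfrac{(1-t)^2}{4}$.
   Context: A bivariate copula is a function $C:[0,1]^2\to[0,1]$ with $C(u,0)=C(0,v)=0$, $C(u,1)=u$, $C(1,v)=v$, that is 2-increasing. $\mathcal{C}$ denotes the set of all bivariate copulas. Blomqvist's beta: $\beta(C)=4C\left(\tfrac12,\tfrac12\right)-1$. Concordance function: for copulas $C_1,C_2$, $\mathcal{Q}(C_1,C_2)=4\int_{[0,1]^2}C_2(u,v)\,dC_1(u,v)-1$, where $dC_1$ denotes integration with respect to the probability measure on $[0,1]^2$ with distribution function $C_1$. Kendall's tau: $\tau(C)=\mathcal{Q}(C,C)$. $\mathcal{B}_t=\{C\in\mathcal{C}:\beta(C)=t\}$; $\underline{B}_t(u,v)=\inf_{C\in\mathcal{B}_t}C(u,v)$ and $\overline{B}_t(u,v)=\sup_{C\in\mathcal{B}_t}C(u,v)$ for all $(u,v)\in[0,1]^2$. These two functions are known to be copulas. *)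

(* Defs.v *)
From HB Require Import structures.
From mathcomp Require Import all_boot all_order all_algebra.
From mathcomp Require Import all_classical all_reals all_analysis.

Set Implicit Arguments.
Unset Strict Implicit.
Unset Printing Implicit Defensive.

Import Order.TTheory GRing.Theory Num.Theory.
Import numFieldNormedType.Exports.

Local Open Scope classical_set_scope.
Local Open Scope ring_scope.

(* A function on [0,1]^2 is encoded as a total function R -> R -> R; only its
   values on the unit square are ever constrained or used. *)
Record is_copula (R : realType) (C : R -> R -> R) : Prop := IsCopula {
  copula_range : forall u v : R, 0 <= u <= 1 -> 0 <= v <= 1 -> 0 <= C u v <= 1;
  copula_u0 : forall u : R, 0 <= u <= 1 -> C u 0 = 0;
  copula_0v : forall v : R, 0 <= v <= 1 -> C 0 v = 0;
  copula_u1 : forall u : R, 0 <= u <= 1 -> C u 1 = u;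
  copula_1v : forall v : R, 0 <= v <= 1 -> C 1 v = v;
  copula_2increasing : forall u1 u2 v1 v2 : R,
    0 <= u1 -> u1 <= u2 -> u2 <= 1 -> 0 <= v1 -> v1 <= v2 -> v2 <= 1 ->
    0 <= C u2 v2 - C u1 v2 - C u2 v1 + C u1 v1 }.

Definition blomqvist_beta (R : realType) (C : R -> R -> R) : R :=
  4 * C 2^-1 2^-1 - 1.

(* A probability measure on [0,1]^2 is encoded as a Borel probability measure on
   R * R; the case u = v = 1 below (with C 1 1 = 1) concentrates it on [0,1]^2. *)
Definition has_copula_df (R : realType)
    (mu : probability (measurableTypeR R * measurableTypeR R)%type R)
    (C : R -> R -> R) : Prop :=
  forall u v : R, 0 <= u <= 1 -> 0 <= v <= 1 ->
    mu (`[0, u] `*` `[0, v]) = (C u v)%:E.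

(* For a copula C such a measure exists and is unique, so get returns it; for
   other functions the value is unspecified. *)
Definition copula_measure (R : realType) (C : R -> R -> R) :
    probability (measurableTypeR R * measurableTypeR R)%type R :=
  get [set mu | has_copula_df mu C].

Definition concordance (R : realType) (C1 C2 : R -> R -> R) : R :=
  4 * (\int[copula_measure C1]_(x in `[0, 1] `*` `[0, 1]) C2 x.1 x.2)%R - 1.

Definition kendall_tau (R : realType) (C : R -> R -> R) : R := concordance C C.

Definition beta_class (R : realType) (t : R) : set (R -> R -> R) :=
  [set C | is_copula C /\ blomqvist_beta C = t].

(* On [0,1]^2 the values C u v lie in [0,1], so for nonempty beta_class t these
   are the true pointwise bounds there. *)
Definition beta_inf (R : realType) (t : R) (u v : R) : R :=
  inf [set C u v | C in beta_class t].

Definition beta_sup (R : realType) (t : R) (u v : R) : R :=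
  sup [set C u v | C in beta_class t].

(* Main.v *)
(** Put [e = (1 - t) / 4] and let [g] exchange the blocks [1/2 - e, 1/2) and
    [1/2, 1/2 + e) by translation.  Monotonicity and the 1-Lipschitz property
    of copulas bound every copula with Blomqvist's beta [t] by
    [min (u, v, 1/2 - e + (u - 1/2)^+ + (v - 1/2)^+)], and this bound is the
    distribution function of [(X, g X)] for [X] uniform on [0, 1]: it is
    therefore a copula [C], and it is the supremum.  Consequently
    [tau = 4 * \int_0^1 C (x, g x) dx - 1], where [C (x, g x)] is [x - e] on
    [1/2, 1/2 + e) and [x] elsewhere.
    The flip [C (u, v) |-> u - C (u, 1 - v)] turns [t] into [- t], suprema into
    infima and [g] into [1 - g]; along the flipped graph the infimum is [e] on
    [1/2, 1/2 + e) and [0] elsewhere. *)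

Require Import Defs.
From HB Require Import structures.
From mathcomp Require Import all_boot all_order all_algebra.
From mathcomp Require Import all_classical all_reals all_analysis.
From mathcomp Require Import measurable_realfun.
From mathcomp Require Import lra ring.

Set Implicit Arguments.
Unset Strict Implicit.
Unset Printing Implicit Defensive.

Import Order.TTheory GRing.Theory Num.Theory.
Import numFieldNormedType.Exports.

Local Open Scope classical_set_scope.
Local Open Scope ring_scope.

(** * Uniqueness of the measure with a given copula as distribution function *)

(** Quadrants are stable under intersection, which makes them the generator for the uniqueness
    argument below. They generate because each half-plane is a countable union of quadrants, so both
    projections are measurable for the sigma-algebra that they span. *)
Lemma prod_measurable_rays (R : realType) :
  @measurable _ (measurableTypeR R * measurableTypeR R)%type =
  <<s [set `]-oo, p.1] `*` `]-oo, p.2] | p in [set: R * R]] >>.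
Proof.
set G := (X in <<s X >>).
have le_nat (y : R) : y <= (Num.truncn `|y|).+1%:R.
  by rewrite (le_trans (ler_norm y))// ltW// truncnS_gt.
have ray (f : R * R -> R) (x : R) : f = fst \/ f = snd ->
    <<s G >> (f @^-1` `]-oo, x]).
  move=> [->|->].
    rewrite [X in <<s G >> X](_ : _ =
        \bigcup_n (`]-oo, x] `*` `]-oo, n%:R])); last first.
      apply/seteqP; split=> [[a b] /= ax|[a b] [n _ [/= ax _]]//].
      by exists (Num.truncn `|b|).+1 => //=; split => //; rewrite /= in_itv/=.
    apply: sigma_algebra_bigcup => n; apply: sub_sigma_algebra.
    by exists (x, n%:R).
  rewrite [X in <<s G >> X](_ : _ =
      \bigcup_n (`]-oo, n%:R] `*` `]-oo, x])); last first.
    apply/seteqP; split=> [[a b] /= ax|[a b] [n _ [/= _ ax]]//].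
    by exists (Num.truncn `|a|).+1 => //=; split => //; rewrite /= in_itv/=.
  apply: sigma_algebra_bigcup => n; apply: sub_sigma_algebra.
  by exists (n%:R, x).
have mproj (f : R * R -> R) : f = fst \/ f = snd ->
    @measurable_fun _ _ (g_sigma_algebraType G) (measurableTypeR R) setT f.
  move=> fE; apply: (measurability _ (RGenOInfty.measurableE R)).
  move=> _ [_ [x ->] <-]; rewrite setTI -setCitvl preimage_setC.
  by apply: sigma_algebraC; exact: ray.
rewrite eqEsubset; split.
  apply: smallest_sub; first exact: smallest_sigma_algebra.
  rewrite subUset; split => _ [A mA <-].
    by apply: (mproj fst _ measurableT) => //; left.
  by apply: (mproj snd _ measurableT) => //; right.
apply: smallest_sub; first exact: smallest_sigma_algebra.
by move=> _ [[u v] _ <-]; apply: measurableX; exact: measurable_itv.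
Qed.

Section copula_df.
Variable R : realType.
Local Notation T2 := (measurableTypeR R * measurableTypeR R)%type.
Implicit Types (mu nu : probability T2 R) (C : R -> R -> R).

(** [C 1 1 = 1] gives the unit square full mass, so a quadrant may be intersected with it. What
    remains is a rectangle anchored at the origin, where [has_copula_df] applies, or the empty
    set. *)
Lemma measure_copula_ray mu C (u v : R) : has_copula_df mu C -> C 1 1 = 1 ->
  mu (`]-oo, u] `*` `]-oo, v]) =
  if (0 <= u) && (0 <= v) then (C (Num.min u 1) (Num.min v 1))%:E else 0%E.
Proof.
move=> muC C11.
pose Q : set T2 := `[0, 1] `*` `[0, 1].
have mQ : measurable Q by apply: measurableX; exact: measurable_itv.
have muQ : mu Q = 1%E by rewrite muC ?lexx ?ler01// C11.
set A := (X in mu X).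
have mA : measurable A by apply: measurableX; exact: measurable_itv.
have -> : mu A = mu (A `&` Q).
  rewrite (measureDI mu mA mQ) [X in (X + _)%E](_ : _ = 0%E) ?add0e//.
  apply: (subset_measure0 (B := ~` Q)) => //.
  - exact: measurableD.
  - exact: measurableC.
  - by apply: etrans (probability_setC mu mQ) _; rewrite muQ subee.
have -> : A `&` Q = if (0 <= u) && (0 <= v)
    then `[0, Num.min u 1] `*` `[0, Num.min v 1] else set0.
  case: ifPn => uv0; rewrite /A /Q;
    apply/seteqP; split => -[x y] //=; rewrite /= !in_itv/=.
  - by rewrite !le_min => -[[-> ->] [/andP[-> ->] /andP[-> ->]]].
  - by rewrite !le_min => -[/and3P[-> -> ->] /and3P[-> -> ->]].
  - move=> [[xu yv] [/andP[x0 _] /andP[y0 _]]]; move: uv0.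
    by rewrite (le_trans x0)// (le_trans y0).
case: ifPn => [/andP[u0 v0]|_]; last exact: measure0.
by rewrite muC// !le_min ?u0 ?v0 ler01 ge_min lexx orbT.
Qed.

(** Two finite measures that agree on the quadrants, a pi-system exhausting the plane, are equal.
    Hence any explicit measure with distribution function [C] may replace the one chosen by [get] in
    [copula_measure]. *)
Lemma has_copula_df_unique mu nu C : C 1 1 = 1 ->
  has_copula_df mu C -> has_copula_df nu C ->
  forall A, measurable A -> mu A = nu A.
Proof.
move=> C11 muC nuC A mA.
pose g n : set T2 := `]-oo, n%:R] `*` `]-oo, n%:R].
apply: (measure_unique _ g (prod_measurable_rays R) _ _ _ mu nu _ _ A mA).
- move=> _ _ [[a b] _ <-] [[c d] _ <-].
  exists (Num.min a c, Num.min b d) => //=; rewrite -setXI.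
  by congr (_ `*` _); apply/seteqP; split=> x /=; rewrite !in_itv/= le_min
    => /andP.
- by move=> n; exists (n%:R, n%:R).
- have le_nat (y : R) : y <= (Num.truncn `|y|)%:R + 1.
    by rewrite (le_trans (ler_norm y))// natr1 ltW// truncnS_gt.
  apply/seteqP; split=> // -[x y] _.
  (* The sum of both truncations is one index that serves both coordinates. *)
  exists (Num.truncn `|x| + Num.truncn `|y|).+1%N => //.
  rewrite /g /= !in_itv/= -natr1 natrD; split.
    by rewrite (le_trans (le_nat x))// lerD2r lerDl.
  by rewrite (le_trans (le_nat y))// lerD2r lerDr.
- move=> _ [[a b] _ <-] /=.
  by rewrite (measure_copula_ray _ _ muC)// (measure_copula_ray _ _ nuC).
- move=> k; rewrite -ge0_fin_numE// fin_num_measure//.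
  by apply: measurableX; exact: measurable_itv.
Qed.

End copula_df.

(** * Laws carried by graphs, and Kendall's tau as a single integral *)

Section copula_graph.
Variable R : realType.
Local Notation T1 := (measurableTypeR R).
Local Notation T2 := (T1 * T1)%type.
Local Notation leb := (@lebesgue_measure R).
Implicit Types (C D : R -> R -> R) (f : {mfun T1 >-> T1}).

(** Inclusion-exclusion for two rectangles anchored at the origin, whose union lies in the largest
    one. Only anchored rectangles occur, the sets whose mass [has_copula_df] prescribes. *)
Lemma has_copula_df_2increasing (mu : probability T2 R) C (u1 u2 v1 v2 : R) :
  has_copula_df mu C ->
  0 <= u1 -> u1 <= u2 -> u2 <= 1 -> 0 <= v1 -> v1 <= v2 -> v2 <= 1 ->
  0 <= C u2 v2 - C u1 v2 - C u2 v1 + C u1 v1.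
Proof.
move=> muC u10 u12 u21 v10 v12 v21.
pose Q (u v : R) : set T2 := `[0, u] `*` `[0, v].
have mQ u v : measurable (Q u v) by apply: measurableX; exact: measurable_itv.
have QE u v : 0 <= u <= 1 -> 0 <= v <= 1 -> mu (Q u v) = (C u v)%:E.
  exact: muC.
have QI : Q u1 v2 `&` Q u2 v1 = Q u1 v1.
  rewrite /Q -setXI; congr (_ `*` _); apply/seteqP;
    split=> x /=; rewrite !in_itv/=.
  - by move=> [].
  - by move=> /andP[-> xu]; rewrite xu (le_trans xu).
  - by move=> [].
  - by move=> /andP[-> xu]; rewrite xu (le_trans xu).
have QU : Q u1 v2 `|` Q u2 v1 `<=` Q u2 v2.
  move=> [x y]; rewrite /Q /= !in_itv/=.
  by move=> [] [/andP[-> xu] /andP[-> yv]] /=; rewrite ?xu ?yv;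
    split; rewrite // (le_trans xu, le_trans yv).
have : (mu (Q u1 v2 `|` Q u2 v1) <= mu (Q u2 v2))%E.
  by rewrite le_measure// inE//; exact: measurableU.
have -> : (mu (Q u1 v2 `|` Q u2 v1) =
    mu (Q u1 v2) + mu (Q u2 v1) - mu (Q u1 v2 `&` Q u2 v1))%E.
  by apply: measureUfinl => //; rewrite -ge0_fin_numE// fin_num_measure.
rewrite QI !QE; try (apply/andP; split; lra).
by rewrite -!EFinD lee_fin; lra.
Qed.

Definition graph f (x : T1) : T2 := (x, f x).

Lemma measurable_graph f : measurable_fun setT (graph f).
Proof. exact: measurable_fun_pair. Qed.

HB.instance Definition _ f :=
  isMeasurableFun.Build _ _ _ _ (graph f) (measurable_graph f).

Definition graph_law f : probability T2 R :=
  distribution (uniform_prob (@ltr01 R)) (graph f).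

Lemma graph_lawE f (A : set T2) : measurable A ->
  graph_law f A = leb (graph f @^-1` A `&` `[0, 1]).
Proof.
move=> mA.
have mgA : measurable (graph f @^-1` A `&` `[0, 1]).
  apply: measurableI; last exact: measurable_itv.
  by rewrite -[X in measurable X]setTI; exact: measurable_graph.
rewrite /= /distribution /pushforward /uniform_prob integral_uniform_pdf.
rewrite (eq_integral (cst 1%E)) ?integral_cst ?mul1e// => x.
by rewrite inE /= in_itv/= /uniform_pdf => -[_ ->]; rewrite subr0 invr1.
Qed.

(** Uniqueness identifies the measure of [C] with the law of the graph, and a change of variables
    then leaves an integral over [0, 1]. The function [D] is a version of [C] measurable on the
    whole plane: the infimum and supremum to which this is applied are controlled on the unit square
    only. *)
Lemma kendall_tau_graph f C D :
  (forall x, 0 <= x <= 1 -> 0 <= f x <= 1) ->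
  measurable_fun [set: T2] (fun p => D p.1 p.2) ->
  (forall u v, 0 <= u <= 1 -> 0 <= v <= 1 -> 0 <= D u v /\ C u v = D u v) ->
  C 1 1 = 1 -> has_copula_df (graph_law f) C ->
  kendall_tau C = 4 * (\int[leb]_(x in `[0, 1]) D x (f x)) - 1.
Proof.
move=> f01 mD CD C11 fC; rewrite /kendall_tau /concordance; congr (4 * _ - 1).
have muC : has_copula_df (copula_measure C) C.
  by apply: (@getPex _ [set mu | has_copula_df mu C]); exists (graph_law f).
pose Q : set T2 := `[0, 1] `*` `[0, 1].
have mQ : measurable Q by apply: measurableX; exact: measurable_itv.
have D0 x : Q x -> 0 <= D x.1 x.2.
  by move=> [/=]; rewrite !in_itv/= => x1 x2; have [] := CD _ _ x1 x2.
rewrite (@eq_Rintegral _ _ _ _ _ (fun x : T2 => D x.1 x.2)); last first.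
  move=> x; rewrite inE => -[/=]; rewrite !in_itv/= => x1 x2.
  by have [_ ->] := CD _ _ x1 x2.
congr (fine _).
transitivity (\int[graph_law f]_(x in Q) (D x.1 x.2)%:E)%E.
  apply: (@eq_measure_integral _ _ _ Q (graph_law f) (copula_measure C)).
  by move=> A mA _; exact: (has_copula_df_unique C11 muC fC mA).
rewrite ge0_integral_pushforward//=; last 2 first.
- exact/measurable_EFinP/measurable_funTS.
- by move=> x; rewrite inE lee_fin => /D0.
have mgQ : measurable (graph f @^-1` Q).
  by rewrite -[X in measurable X]setTI; exact: measurable_graph.
(* The restriction to [Q] moves into the integrand; over [0, 1] it disappears, since the graph stays
   in [Q] there. *)
rewrite integral_mkcond integral_uniform /=.
- rewrite subr0 invr1 mul1e; apply: eq_integral => x.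
  rewrite inE/= in_itv/= => x01; rewrite patchE mem_set//.
  by rewrite /Q/graph/= !in_itv/= x01 f01.
- apply/(measurable_restrictT _ _).1 => //.
  apply/measurable_EFinP/measurable_funTS.
  exact: (measurableT_comp mD (measurable_graph f)).
- move=> x; rewrite patchE; case: ifPn => //.
  by rewrite inE => /D0; rewrite lee_fin.
Qed.
End copula_graph.

(** * Length of a set known up to the endpoints of two intervals *)

Section lebesgue_sandwich.
Variable R : realType.
Local Notation T1 := (measurableTypeR R).
Local Notation leb := (@lebesgue_measure R).

(** Endpoints are null. When [b = c] the open intervals are still disjoint, and for the closed ones
    subadditivity suffices. *)
Lemma lebesgue_measure_sandwich2 (a b c d : R) (A : set T1) :
  measurable A -> a <= b -> b <= c -> c <= d ->
  `]a, b[ `|` `]c, d[ `<=` A -> A `<=` `[a, b] `|` `[c, d] ->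
  leb A = (b - a + (d - c))%:E.
Proof.
move=> mA ab bc cd oA Ac.
have itvE (l r : bool) (x y : R) : x <= y -> leb
    [set` Interval (BSide l x) (BSide r y)] = (y - x)%:E.
  rewrite le_eqVlt => /predU1P[->|xy]; rewrite lebesgue_measure_itv/= lte_fin.
    by rewrite ltxx subrr.
  by rewrite xy EFinB.
have mI (l r : bool) (x y : R) :
    measurable ([set` Interval (BSide l x) (BSide r y)] : set T1).
  exact: measurable_itv.
apply/eqP; rewrite eq_le; apply/andP; split.
  have : (leb A <= leb (`[a, b] `|` `[c, d] : set T1))%E.
    by apply: le_measure; rewrite ?inE//; exact: measurableU.
  move=> /le_trans; apply.
  have : (leb (`[a, b] `|` `[c, d] : set T1) <=
      leb (`[a, b] : set T1) + leb (`[c, d] : set T1))%E.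
    exact: measureU2.
  by rewrite !itvE// -EFinD.
have : (leb (`]a, b[ `|` `]c, d[ : set T1) <= leb A)%E.
  by apply: le_measure; rewrite ?inE//; exact: measurableU.
apply: le_trans.
have -> : leb (`]a, b[ `|` `]c, d[ : set T1) =
    (leb (`]a, b[ : set T1) + leb (`]c, d[ : set T1))%E.
  apply: measureU => //; apply/seteqP; split=> // x /=.
  rewrite !in_itv/= => -[/andP[_ xb] /andP[cx _]].
  by move: (lt_trans cx xb); rewrite ltNge bc.
by rewrite !itvE// -EFinD.
Qed.
End lebesgue_sandwich.

(** * The block exchange and the shape of its sublevel sets *)

Section block_swap_cut.
Variable R : realFieldType.
Implicit Types e u v x p q : R.

Definition block_swap e x : R :=
  if (2^-1 - e <= x) && (x < 2^-1) then x + e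
  else if (2^-1 <= x) && (x < 2^-1 + e) then x - e else x.

(** The pointwise upper bound for copulas with value [2^-1 - e] at the centre of the square. *)
Definition beta_upper e u v : R :=
  Num.min (Num.min u v)
    (2^-1 - e + Num.max 0 (u - 2^-1) + Num.max 0 (v - 2^-1)).

Lemma block_swapP e x : 0 <= e ->
  [\/ [/\ 2^-1 - e <= x, x < 2^-1 & block_swap e x = x + e],
      [/\ 2^-1 <= x, x < 2^-1 + e & block_swap e x = x - e],
      x < 2^-1 - e /\ block_swap e x = x |
      2^-1 + e <= x /\ block_swap e x = x].
Proof.
move=> e0; rewrite /block_swap.
have [x2|x2] := ltP x 2^-1; rewrite ?andbT ?andbF /=.
  by have [?|?] := leP (2^-1 - e) x; [constructor 1|constructor 3].
by have [?|?] := ltP x (2^-1 + e); [constructor 2|constructor 4].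
Qed.

Lemma block_swap_range e x : 0 <= e <= 2^-1 ->
  0 <= x <= 1 -> 0 <= block_swap e x <= 1.
Proof.
move=> /andP[e0 e1] /andP[x0 x1].
by case: (block_swapP x e0) => -[? ?]; [move=> ->|move=> ->|subst|subst];
  apply/andP; split; lra.
Qed.

(* Up to endpoints, [block_swap e x <= v] cuts [0, 1/2] down to [0, p] and
   [1/2, 1] down to [1/2, q]. *)
Definition is_cut e v p q :=
  [\/ [/\ v < 2^-1 - e, p = v & q = 2^-1],
      [/\ 2^-1 - e <= v, v < 2^-1, p = 2^-1 - e & q = v + e],
      [/\ 2^-1 <= v, v < 2^-1 + e, p = v - e & q = 2^-1 + e] |
      [/\ 2^-1 + e <= v, p = 2^-1 & q = v]].

Lemma is_cut_exists e v : exists p q, is_cut e v p q.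
Proof.
have [v2|v2] := ltP v 2^-1.
  have [ve|ve] := ltP v (2^-1 - e).
    by exists v, 2^-1; constructor 1.
  by exists (2^-1 - e), (v + e); constructor 2.
have [ve|ve] := ltP v (2^-1 + e).
  by exists (v - e), (2^-1 + e); constructor 3.
by exists 2^-1, v; constructor 4.
Qed.

Lemma is_cut_bounds e v p q : 0 <= e <= 2^-1 -> 0 <= v <= 1 ->
  is_cut e v p q -> [/\ 0 <= p, p <= 2^-1 & 2^-1 <= q].
Proof.
move=> /andP[e0 e1] /andP[v0 v1].
by case=> [[? -> ->]|[? ? -> ->]|[? ? -> ->]|[? -> ->]]; split; lra.
Qed.

Lemma is_cut_lt e v p q x : 0 <= e <= 2^-1 -> is_cut e v p q ->
  x < p \/ 2^-1 < x < q -> block_swap e x < v.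
Proof.
move=> /andP[e0 e1] cut xpq; have {}xpq : x < p \/ (2^-1 < x /\ x < q).
  by case: xpq => [|/andP[]]; [left|right].
case: cut xpq => [[? -> ->]|[? ? -> ->]|[? ? -> ->]|[? -> ->]];
case: (block_swapP x e0) => [[? ? ->]|[? ? ->]|[? ->]|[? ->]];
by case=> [?|[? ?]]; lra.
Qed.

Lemma is_cut_le e v p q x : 0 <= e <= 2^-1 -> is_cut e v p q ->
  block_swap e x <= v -> if x < 2^-1 then x <= p else x <= q.
Proof.
move=> /andP[e0 e1].
case=> [[? -> ->]|[? ? -> ->]|[? ? -> ->]|[? -> ->]];
case: (block_swapP x e0) => [[? ? ->]|[? ? ->]|[? ->]|[? ->]];
by case: ifPn; rewrite -?leNgt; lra.
Qed.

(** The left side is the total length of [0, min(u, p)] and [1/2, min(u, q)]; the maximum makes the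
    second length zero when [u] is below 1/2. Locating [u] and [v] relative to the blocks resolves
    the minima and maxima as far as needed, and linear arithmetic does the rest. *)
Lemma is_cut_value e v p q u : 0 <= e <= 2^-1 -> 0 <= u <= 1 -> 0 <= v <= 1 ->
  is_cut e v p q ->
  Num.min u p + (Num.max 2^-1 (Num.min u q) - 2^-1) = beta_upper e u v.
Proof.
move=> /andP[e0 e1] /andP[u0 u1] /andP[v0 v1] H; rewrite /beta_upper.
have [u2|u2] := leP u 2^-1.
  rewrite (max_idPl (_ : u - 2^-1 <= 0)) ?subr_le0// addr0.
  rewrite (max_idPl (_ : Num.min u q <= 2^-1)) ?ge_min ?u2//.
  rewrite subrr addr0 -minA.
  case: H => [[v2 -> _]|[v2 v3 -> _]|[v2 v3 -> _]|[v2 -> _]].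
  - rewrite (max_idPl (_ : v - 2^-1 <= 0)); last by lra.
    by rewrite addr0 (min_idPl (_ : v <= 2^-1 - e))// ltW.
  - rewrite (max_idPl (_ : v - 2^-1 <= 0)); last by lra.
    by rewrite addr0 (min_idPr (_ : 2^-1 - e <= v)).
  - rewrite (max_idPr (_ : 0 <= v - 2^-1)); last by lra.
    by rewrite (min_idPr (_ : 2^-1 - e + (v - 2^-1) <= v));
      [congr Num.min|]; lra.
  - rewrite (max_idPr (_ : 0 <= v - 2^-1)); last by lra.
    rewrite (min_idPr (_ : 2^-1 - e + (v - 2^-1) <= v)); last by lra.
    by rewrite !(min_idPl _)//; lra.
rewrite (max_idPr (_ : 0 <= u - 2^-1)); last by lra.
case: H => [[v2 -> ->]|[v2 v3 -> ->]|[v2 v3 -> ->]|[v2 -> ->]].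
- rewrite (max_idPl (_ : v - 2^-1 <= 0)); last by lra.
  rewrite (min_idPr (_ : v <= u)); last by lra.
  rewrite (min_idPr (_ : 2^-1 <= u)); last by lra.
  rewrite maxxx (min_idPl (_ : v <= _)); last by lra.
  by rewrite subrr addr0.
- rewrite (max_idPl (_ : v - 2^-1 <= 0)); last by lra.
  rewrite (min_idPr (_ : v <= u)); last by lra.
  rewrite (min_idPr (_ : 2^-1 - e <= u)); last by lra.
  (* Here [q = v + e] may lie on either side of [u], and the side decides which term of the outer
     minimum is attained. *)
  have [?|?] := leP u (v + e).
    rewrite (max_idPr (_ : 2^-1 <= u)); last by lra.
    by rewrite (min_idPr _); lra.
  rewrite (max_idPr (_ : 2^-1 <= v + e)); last by lra.
  by rewrite (min_idPl _); lra.
- rewrite (max_idPr (_ : 0 <= v - 2^-1)); last by lra.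
  rewrite (min_idPr (_ : v - e <= u)); last by lra.
  have [?|?] := leP u (2^-1 + e).
    rewrite (max_idPr (_ : 2^-1 <= u)); last by lra.
    rewrite (min_idPr _); first by lra.
    by rewrite le_min; apply/andP; split; lra.
  rewrite (max_idPr (_ : 2^-1 <= 2^-1 + e)); last by lra.
  rewrite (min_idPr (_ : v <= u)); last by lra.
  by rewrite (min_idPl _); lra.
- rewrite (max_idPr (_ : 0 <= v - 2^-1)); last by lra.
  rewrite (min_idPr (_ : 2^-1 <= u)); last by lra.
  rewrite (max_idPr _); last by rewrite le_min; apply/andP; split; lra.
  rewrite (min_idPl (_ : Num.min u v <= _)); first by lra.
  by rewrite ge_min; apply/orP; left; lra.
Qed.

End block_swap_cut.

(** * Measurability of the exchange and the length of its sublevel sets *)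

Section block_swap.
Variable R : realType.
Local Notation T1 := (measurableTypeR R).
Local Notation T2 := (T1 * T1)%type.
Local Notation leb := (@lebesgue_measure R).

Lemma measurable_block_swap (e : R) :
  measurable_fun setT (block_swap e : T1 -> T1).
Proof.
apply: measurable_fun_ifT.
- apply: measurable_and; first exact: measurable_fun_ler.
  exact: measurable_fun_ltr.
- exact: measurable_funD.
apply: measurable_fun_ifT => //.
- apply: measurable_and; first exact: measurable_fun_ler.
  exact: measurable_fun_ltr.
- exact: measurable_funB.
Qed.

HB.instance Definition _ (e : R) :=
  isMeasurableFun.Build _ _ _ _ (block_swap e : T1 -> T1)
    (measurable_block_swap e).

Definition block_flip (e : R) (x : T1) : T1 := 1 - block_swap e x.

Lemma measurable_block_flip (e : R) : measurable_fun setT (block_flip e).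
Proof. by apply: measurable_funB => //; exact: measurable_block_swap. Qed.

HB.instance Definition _ (e : R) :=
  isMeasurableFun.Build _ _ _ _ (block_flip e) (measurable_block_flip e).

(** Any [A] between the strict and the weak sublevel set is allowed: the exchange itself leads to
    the weak one, its flip to the strict one. *)
Lemma lebesgue_block_swap (e u v : R) (A : set T1) :
  0 <= e <= 2^-1 -> 0 <= u <= 1 -> 0 <= v <= 1 -> measurable A ->
  [set x | 0 <= x <= u /\ block_swap e x < v] `<=` A ->
  A `<=` [set x | 0 <= x <= u /\ block_swap e x <= v] ->
  leb A = (beta_upper e u v)%:E.
Proof.
move=> e01 u01 v01 mA sA As.
have [p [q cut]] := is_cut_exists e v.
have [p0 p2 q2] := is_cut_bounds e01 v01 cut.
have /andP[u0 u1] := u01.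
(* The maximum keeps the four endpoints ordered when [u] is below 1/2; the second interval then
   shrinks to a point. *)
rewrite (@lebesgue_measure_sandwich2 _ 0 (Num.min u p) 2^-1
  (Num.max 2^-1 (Num.min u q)))//.
- by rewrite -(is_cut_value e01 u01 v01 cut) subr0.
- by rewrite le_min u0.
- by rewrite ge_min p2 orbT.
- by rewrite le_max lexx.
- apply: subset_trans sA => x /=; rewrite !in_itv/= lt_min lt_max lt_min.
  case=> [/and3P[x0 xu xp]|/andP[x2]].
    by split; [rewrite !ltW|apply: (is_cut_lt e01 cut); left].
  rewrite ltNge (ltW x2)/= => /andP[xu xq].
  split; first by rewrite (ltW xu) andbT; lra.
  by apply: (is_cut_lt e01 cut); right; rewrite x2.
- apply: subset_trans As _ => x /= [/andP[x0 xu] /(is_cut_le e01 cut)].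
  rewrite !in_itv/= x0 le_min xu le_max le_min xu.
  by case: ltP => [x2 ->|x2 ->]; [left|right; rewrite orbT].
Qed.
End block_swap.

(** * Symmetries of copulas and the pointwise bounds *)

Section copula_bounds.
Variable R : realType.
Implicit Types (C : R -> R -> R) (e t u v : R).

(** If (U, V) has distribution function [C], this is the one of (U, 1 - V). The 2-increasing
    property is that of [C] on the reflected rectangle. *)
Lemma copula_flip C : is_copula C -> is_copula (fun u v => u - C u (1 - v)).
Proof.
move=> [rg u0 v0 u1 v1 inc].
have I v : 0 <= v <= 1 -> 0 <= 1 - v <= 1 by lra.
split=> [u v hu hv|u hu|v hv|u hu|v hv|u1' u2 v1' v2 *].
- have /andP[? ?] := rg u _ hu (I _ hv).
  have : C u (1 - v) <= u; last by lra.
  have := inc 0 u (1 - v) 1; rewrite u1 // !v0 ?lexx ?ler01 ?I//; lra.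
- by rewrite subr0 u1// subrr.
- by rewrite v0 ?subrr// I.
- by rewrite subrr u0// subr0.
- by rewrite v1 ?I//; lra.
- by have := inc u1' u2 (1 - v2) (1 - v1'); lra.
Qed.

Lemma copula_swap C : is_copula C -> is_copula (fun u v => C v u).
Proof.
move=> [rg u0 v0 u1 v1 inc]; split=> //; first by move=> *; exact: rg.
by move=> u1' u2 v1' v2 *; have := inc v1' v2 u1' u2; lra.
Qed.

(** The rectangle up to the edge at height 1 gives the Lipschitz bound when [u' <= u]; the rectangle
    down to height 0 gives monotonicity otherwise. The maximum joins both cases and produces the
    positive parts in [beta_upper]. *)
Lemma copula_lipschitz C u u' v : is_copula C ->
  0 <= u <= 1 -> 0 <= u' <= 1 -> 0 <= v <= 1 ->
  C u v <= C u' v + Num.max 0 (u - u').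
Proof.
move=> [_ u0 _ u1 _ inc] hu hu' hv.
have [uu'|u'u] := leP 0 (u - u').
  by have := inc u' u v 1; rewrite !u1//; lra.
by have := inc u u' 0 v; rewrite !u0//; lra.
Qed.

(** The three terms come from comparing (u, v) with (0, v), with (u, 0), and with the centre by way
    of (1/2, v). *)
Lemma copula_le_beta_upper C e u v : is_copula C -> C 2^-1 2^-1 = 2^-1 - e ->
  0 <= u <= 1 -> 0 <= v <= 1 -> C u v <= beta_upper e u v.
Proof.
move=> cC Ce hu hv.
have h2 : 0 <= (2^-1 : R) <= 1 by apply/andP; split; lra.
have h0 : 0 <= (0 : R) <= 1 by rewrite lexx ler01.
rewrite /beta_upper !le_min; apply/andP; split; first (apply/andP; split).
- have := copula_lipschitz cC hu h0 hv.
  by rewrite subr0 (copula_0v cC)// add0r (max_idPr _)//; case/andP: hu.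
- have := copula_lipschitz (copula_swap cC) hv h0 hu.
  by rewrite subr0 (copula_u0 cC)// add0r (max_idPr _)//; case/andP: hv.
have := copula_lipschitz cC hu h2 hv.
have := copula_lipschitz (copula_swap cC) hv h2 h2.
by rewrite /= Ce; lra.
Qed.

(** The flip of [C] has value [2^-1 - e] at the centre, so the upper bound applies to it. *)
Lemma beta_upper_lower_flip C e u v : is_copula C -> C 2^-1 2^-1 = e ->
  0 <= u <= 1 -> 0 <= v <= 1 -> u - beta_upper e u (1 - v) <= C u v.
Proof.
move=> cC Ce hu hv.
have hv' : 0 <= 1 - v <= 1 by lra.
have half : 1 - 2^-1 = 2^-1 :> R by lra.
have := copula_le_beta_upper (copula_flip cC) _ hu hv'.
move=> /(_ e); rewrite half Ce => /(_ erefl).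
by rewrite (_ : 1 - (1 - v) = v); lra.
Qed.

End copula_bounds.

(** * The bounds as distribution functions of graph laws *)

Section block_laws.
Variable R : realType.
Implicit Types (e t u v : R).
Local Notation T1 := (measurableTypeR R).
Local Notation T2 := (T1 * T1)%type.
Local Notation leb := (@lebesgue_measure R).

Lemma block_swap_copula_df e : 0 <= e <= 2^-1 ->
  has_copula_df (graph_law (block_swap e)) (beta_upper e).
Proof.
move=> e01 u v hu hv.
rewrite graph_lawE; last by apply: measurableX; exact: measurable_itv.
apply: lebesgue_block_swap => //.
- rewrite -[X in X `&` _]setTI; apply: measurableI; last exact: measurable_itv.
  apply: (measurable_graph (block_swap e)) => //.
  by apply: measurableX; exact: measurable_itv.
- move=> x; rewrite /graph/= !in_itv/= => -[/andP[x0 xu] xv].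
  have x01 : 0 <= x <= 1 by rewrite x0 (le_trans xu)//; case/andP: hu.
  have /andP[g0 _] := block_swap_range e01 x01.
  by rewrite x0 xu g0 (ltW xv); case/andP: x01.
- by move=> x; rewrite /graph/= !in_itv/= => -[[xu /andP[_ ?]] _].
Qed.

(** The condition [block_flip e x <= v] means [1 - v <= block_swap e x], so the set to measure is
    [0, u] minus a strict sublevel set of the exchange. *)
Lemma block_flip_copula_df e : 0 <= e <= 2^-1 ->
  has_copula_df (graph_law (block_flip e))
    (fun u v => u - beta_upper e u (1 - v)).
Proof.
move=> e01 u v hu hv.
rewrite graph_lawE; last by apply: measurableX; exact: measurable_itv.
pose B : set T1 := [set x | 0 <= x <= u /\ block_swap e x < 1 - v].
have mB : measurable B.
  rewrite [B](_ : _ = `[0, u] `&` block_swap e @^-1` `]-oo, 1 - v[); last first.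
    by apply/seteqP; split=> x /=; rewrite !in_itv/=.
  apply: measurableI; first exact: measurable_itv.
  by rewrite -[X in measurable X]setTI; apply: measurable_block_swap.
have BE : leb B = (beta_upper e u (1 - v))%:E.
  apply: lebesgue_block_swap => //; first by lra.
  by move=> x [? /ltW ?].
pose I : set T1 := [set` `[0, u]].
have BI : B `<=` I by move=> x [xu _]; rewrite /I /= in_itv.
have IE : leb I = u%:E.
  rewrite lebesgue_measure_itv/= lte_fin; have /andP[u0 _] := hu.
  by move: u0; rewrite le_eqVlt => /predU1P[<-|->]; rewrite ?ltxx// sube0.
rewrite [X in leb X](_ : _ = I `\` B); last first.
  have ux x : 0 <= x <= u -> 0 <= x <= 1.
    by move=> /andP[-> xu]; rewrite (le_trans xu)//; case/andP: hu.
  apply/seteqP; split=> x; rewrite /I /graph/= /block_flip !in_itv/=.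
    by move=> [[xu gx] _]; split=> // -[_ gx']; lra.
  move=> [xu nB]; have x01 := ux x xu; have := block_swap_range e01 x01.
  have : 1 - v <= block_swap e x by rewrite leNgt; apply/negP => ?; exact: nB.
  by move=> gv /andP[g0 g1]; rewrite xu x01; split=> //; split=> //; lra.
have -> : leb (I `\` B) = (leb I - leb B)%E.
  rewrite -[in RHS](setIidr BI); apply: measureD => //;
    first exact: measurable_itv.
  by change (leb I < +oo)%E; rewrite IE ltry.
by rewrite IE BE.
Qed.
End block_laws.

(** * Attainment of the bounds and the integrals along the graphs *)

Section block_tau.
Variable R : realType.
Implicit Types (e t u v x : R).
Local Notation T1 := (measurableTypeR R).
Local Notation T2 := (T1 * T1)%type.
Local Notation leb := (@lebesgue_measure R).

(** Nonnegativity and the 2-increasing property are inherited from the graph law; the boundary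
    values are read off the formula. *)
Lemma beta_upper_copula e : 0 <= e <= 2^-1 -> is_copula (beta_upper e).
Proof.
move=> e01; have fC := block_swap_copula_df e01.
have ge0 u v : 0 <= u <= 1 -> 0 <= v <= 1 -> 0 <= beta_upper e u v.
  by move=> hu hv; rewrite -lee_fin -fC.
have leu u v : beta_upper e u v <= u by rewrite /beta_upper !ge_min lexx.
have lev u v : beta_upper e u v <= v by rewrite /beta_upper !ge_min lexx orbT.
have h0 : 0 <= (0 : R) <= 1 by rewrite lexx ler01.
have M x : 2^-1 <= 2^-1 + Num.max 0 (x - 2^-1).
  by rewrite lerDl le_max lexx.
have M' x : x <= 2^-1 + Num.max 0 (x - 2^-1).
  by rewrite -lerBlDl le_max lexx orbT.
have /andP[e0 e2] := e01.
have M1 : Num.max 0 (1 - 2^-1) = 2^-1 :> R by rewrite (max_idPr _); lra.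
split=> [u v hu hv|u hu|v hv|u hu|v hv|u1 u2 v1 v2].
- by rewrite ge0//= (le_trans (leu u v))//; case/andP: hu.
- by apply/le_anti; rewrite lev ge0.
- by apply/le_anti; rewrite leu ge0.
- have /andP[_ u1] := hu.
  by rewrite /beta_upper (min_idPl u1) M1 (min_idPl _)//; have := M' u; lra.
- have /andP[_ v1] := hv.
  by rewrite /beta_upper (min_idPr v1) M1 (min_idPl _)//; have := M' v; lra.
- exact: has_copula_df_2increasing fC.
Qed.

Lemma beta_upper_half e : 0 <= e -> beta_upper e 2^-1 2^-1 = 2^-1 - e.
Proof.
move=> e0; rewrite /beta_upper minxx subrr maxxx !addr0.
by rewrite (min_idPr _)//; lra.
Qed.

(** This [e] solves [4 * (2^-1 - e) - 1 = t], so the bound is itself in the class and the supremum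
    is a maximum. *)
Lemma beta_supE t u v : -1 <= t <= 1 -> 0 <= u <= 1 -> 0 <= v <= 1 ->
  beta_sup t u v = beta_upper ((1 - t) / 4) u v.
Proof.
move=> ht hu hv; set e := (1 - t) / 4.
have e01 : 0 <= e <= 2^-1 by rewrite /e; lra.
have ub : ubound [set C u v | C in beta_class t] (beta_upper e u v).
  move=> _ [C [cC bC] <-]; apply: copula_le_beta_upper => //.
  by move: bC; rewrite /blomqvist_beta /e; lra.
have att : [set C u v | C in beta_class t] (beta_upper e u v).
  exists (beta_upper e) => //; split; first exact: beta_upper_copula.
  by rewrite /blomqvist_beta beta_upper_half; rewrite /e; lra.
apply/le_anti/andP; split.
  by apply: ge_sup ub; exists (beta_upper e u v).
by apply: ub_le_sup => //; exists (beta_upper e u v).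
Qed.

(** The flipped bound has value [e] at the centre, and [4 * e - 1 = t]; the infimum is therefore a
    minimum. *)
Lemma beta_infE t u v : -1 <= t <= 1 -> 0 <= u <= 1 -> 0 <= v <= 1 ->
  beta_inf t u v = u - beta_upper ((1 + t) / 4) u (1 - v).
Proof.
move=> ht hu hv; set e := (1 + t) / 4.
have e01 : 0 <= e <= 2^-1 by rewrite /e; lra.
have lb : lbound [set C u v | C in beta_class t] (u - beta_upper e u (1 - v)).
  move=> _ [C [cC bC] <-]; apply: beta_upper_lower_flip => //.
  by move: bC; rewrite /blomqvist_beta /e; lra.
have att : [set C u v | C in beta_class t] (u - beta_upper e u (1 - v)).
  exists (fun u v => u - beta_upper e u (1 - v)) => //.
  split; first exact/copula_flip/beta_upper_copula.
  rewrite /blomqvist_beta (_ : 1 - 2^-1 = 2^-1); last by lra.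
  by rewrite beta_upper_half; rewrite /e; lra.
apply/le_anti/andP; split.
  by apply: ge_inf att; exists (u - beta_upper e u (1 - v)).
by apply: lb_le_inf => //; exists (u - beta_upper e u (1 - v)).
Qed.

Lemma measurable_beta_upper e :
  measurable_fun [set: T2] (fun p => beta_upper e p.1 p.2).
Proof.
have m1 : measurable_fun [set: T2] (fst : T2 -> R) by exact: measurable_fst.
have m2 : measurable_fun [set: T2] (snd : T2 -> R) by exact: measurable_snd.
have mx (f : T2 -> R) : measurable_fun setT f ->
    measurable_fun setT (fun p => Num.max 0 (f p - 2^-1)).
  by move=> mf; apply: measurable_maxr => //; exact: measurable_funB.
apply: measurable_minr; first exact: measurable_minr.
apply: measurable_funD; last exact: mx.
by apply: measurable_funD; last exact: mx.
Qed.

Lemma Rintegral_id01 : \int[leb]_(x in `[0, 1]) x = 2^-1.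
Proof.
pose F (x : R) := x ^+ 2 / 2.
have dF (x : R) : is_derive x 1 F x.
  by apply: is_derive_eq; rewrite /GRing.scale/=; lra.
have cF (x : R) : {for x, continuous F}.
  by apply: differentiable_continuous; apply/derivable1_diffP; case: (dF x).
rewrite /Rintegral (continuous_FTC2 (F := F))//.
- by rewrite /F/= expr1n expr0n/= mul0r subr0 mul1r.
- by apply: continuous_subspaceT => x; exact: cvg_id.
- split.
  + by move=> x _; case: (dF x).
  + exact/cvg_at_right_filter/cF.
  + exact/cvg_at_left_filter/cF.
- by move=> x _; rewrite derive1E; case: (dF x).
Qed.

Lemma Rintegral_block e : 0 <= e <= 2^-1 ->
  \int[leb]_(x in `[0, 1]) (e * \1_`[2^-1, 2^-1 + e[ x) = e ^+ 2.
Proof.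
move=> /andP[e0 e2].
have mJ : measurable (`[2^-1, 2^-1 + e[ : set T1) by exact: measurable_itv.
have mI : measurable (`[0, 1] : set T1) by exact: measurable_itv.
have JE : leb `[2^-1, 2^-1 + e[ = e%:E.
  rewrite lebesgue_measure_itv/= lte_fin ltrDl.
  have [e0'|e0'] := ltP 0 e; first by rewrite -EFinD/= addrC addKr.
  by congr EFin; apply/le_anti; rewrite e0 e0'.
rewrite RintegralZl//; last first.
  exact: integrableS (integrable_indic_itv _ _ _ _).
rewrite expr2; congr (_ * _); rewrite /Rintegral integral_indic//.
(* [e <= 2^-1] keeps the block inside [0, 1]. *)
rewrite setIidl; last first.
  by move=> x /=; rewrite !in_itv/= => /andP[? ?]; apply/andP; split; lra.
exact: (congr1 fine JE).
Qed.

Lemma Rintegral_id_sub_block e : 0 <= e <= 2^-1 ->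
  \int[leb]_(x in `[0, 1]) (x - e * \1_`[2^-1, 2^-1 + e[ x) = 2^-1 - e ^+ 2.
Proof.
move=> e01; have mI : measurable (`[0, 1] : set T1) by exact: measurable_itv.
rewrite RintegralB ?Rintegral_id01 ?Rintegral_block//.
- apply: continuous_compact_integrable; first exact: segment_compact.
  by apply: continuous_subspaceT => x; exact: cvg_id.
- rewrite (_ : EFin \o _ = (fun x => e%:E * (\1_`[2^-1, 2^-1 + e[ x)%:E)%E)//.
  apply: integrableZl => //.
  exact: integrableS (integrable_indic_itv _ _ _ _).
Qed.

(** On the lower block the third term of the minimum equals [x], on the upper block [x - e]; in both
    it ties with the smaller coordinate. Off the blocks both coordinates are [x] and the third term
    is at least [x]. *)
Lemma beta_upper_diag e x : 0 <= e <= 2^-1 -> 0 <= x <= 1 ->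
  beta_upper e x (block_swap e x) = x - e * \1_`[2^-1, 2^-1 + e[ x.
Proof.
move=> /andP[e0 e2] /andP[x0 x1]; rewrite /beta_upper indicE mem_setE in_itv/=.
have M (y : R) : 2^-1 <= y -> Num.max 0 (y - 2^-1) = y - 2^-1.
  by move=> y2; rewrite (max_idPr _)//; lra.
have m (y : R) : y <= 2^-1 -> Num.max 0 (y - 2^-1) = 0.
  by move=> y2; rewrite (max_idPl _)//; lra.
have [[xl xr ->]|[xl xr ->]|[xr ->]|[xl ->]] := block_swapP x e0.
- rewrite leNgt xr/= mulr0 subr0 (m x (ltW xr)) (M (x + e)); last by lra.
  by rewrite (min_idPl (_ : x <= x + e)) ?(min_idPl _)//; lra.
- rewrite xl xr/= mulr1 (M x xl) (m (x - e)); last by lra.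
  by rewrite (min_idPr (_ : x - e <= x)) ?(min_idPl _)//; lra.
- rewrite (leNgt _ x) (lt_le_trans xr) ?gerBl//= mulr0 subr0 minxx.
  by rewrite (m x) ?(min_idPl _)//; lra.
- rewrite (ltNge x) xl andbF/= mulr0 subr0 minxx.
  by rewrite (M x) ?(min_idPl _)//; lra.
Qed.

End block_tau.

(** * Kendall's tau of the two bounds *)

Theorem theorem5 (R : realType) (t : R) (ht : -1 <= t <= 1) :
  kendall_tau (beta_inf t) = (1 + t) ^+ 2 / 4 - 1 /\
  kendall_tau (beta_sup t) = 1 - (1 - t) ^+ 2 / 4.
Proof.
split.
- set e := (1 + t) / 4; have e01 : 0 <= e <= 2^-1 by rewrite /e; lra.
  have cL := copula_flip (beta_upper_copula e01).
  rewrite (@kendall_tau_graph _ (block_flip e) _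
      (fun u v => u - beta_upper e u (1 - v))).
  + rewrite (_ : (1 + t) ^+ 2 / 4 = 4 * e ^+ 2); last by rewrite /e; field.
    rewrite -(Rintegral_block e01); congr (4 * _ - 1).
    apply: eq_Rintegral => x; rewrite inE/= in_itv/= => x01.
    (* The two reflections cancel, leaving [x] minus the upper bound along the unflipped graph,
       which is [e] on the upper block and 0 elsewhere. *)
    by rewrite /block_flip subKr (beta_upper_diag e01 x01) subKr.
  + move=> x /(block_swap_range e01) /andP[g0 g1].
    by rewrite /block_flip subr_ge0 gerBl g0 g1.
  + apply: measurable_funB; first exact: measurable_fst.
    apply: (measurableT_comp (measurable_beta_upper e)
      (g := fun p : measurableTypeR R * measurableTypeR R => (p.1, 1 - p.2))).
    apply: measurable_fun_pair; first exact: measurable_fst.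
    by apply: measurable_funB => //; exact: measurable_snd.
  + move=> u v hu hv; rewrite beta_infE//.
    by split=> //; case/andP: (copula_range cL hu hv).
  + by rewrite beta_infE ?lexx ?ler01// (copula_u1 cL) ?lexx ?ler01.
  + by move=> u v hu hv; rewrite beta_infE//; exact: block_flip_copula_df.
- set e := (1 - t) / 4; have e01 : 0 <= e <= 2^-1 by rewrite /e; lra.
  have cU := beta_upper_copula e01.
  rewrite (@kendall_tau_graph _ (block_swap e) _ (beta_upper e)).
  + rewrite (_ : (1 - t) ^+ 2 / 4 = 4 * e ^+ 2); last by rewrite /e; field.
    rewrite (_ : \int[_]_(x in _) _ = 2^-1 - e ^+ 2); first by field.
    rewrite -(Rintegral_id_sub_block e01); apply: eq_Rintegral => x.
    by rewrite inE/= in_itv/= => x01; rewrite (beta_upper_diag e01 x01).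
  + by move=> x; exact: block_swap_range.
  + exact: measurable_beta_upper.
  + move=> u v hu hv; rewrite beta_supE//.
    by split=> //; case/andP: (copula_range cU hu hv).
  + by rewrite beta_supE ?lexx ?ler01// (copula_u1 cU) ?lexx ?ler01.
  + by move=> u v hu hv; rewrite beta_supE//; exact: block_swap_copula_df.
Qed.
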